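(* Let $k\ge 0$, $\ell\ge 0$ and $n\ge 2$ be integers. For $\omega\in\mathfrak{B}_n$ chosen uniformly at random, with $\alpha=\alpha(\omega)$ and $\beta=\beta(\omega)$, $$\mathbb{E}\left[\alpha^k\beta^\ell\right]=\frac{k!\,\ell!}{2^{k+\ell}\,\mathfrak{b}_n}\left[t^{n+2}u^kv^\ell\right]\frac{\left(g_k\left(te^{(1-t)u}\right)-\mathbf{1}_{\{k=0\}}\right)^2\left(g_\ell\left(te^{(1-t)v}\right)-\mathbf{1}_{\{\ell=0\}}\right)^2}{(1-t)^{k+\ell}}.$$
   Context: $\mathfrak{S}_n$ is the set of permutations of $[n]=\{1,\dots,n\}$, in one-line notation. A reduction of $\omega\in\mathfrak{S}_n$ interchanges $\omega(i)$ and $\omega(j)$ for some $i<j$ with $\omega(i)>\omega(j)$. Bruhat order: $\pi\le\sigma$ if $\pi$ is obtained from $\sigma$ by a (possibly empty) sequence of reductions. $\mathfrak{B}_n\subseteq\mathfrak{S}_n$ is the set of bigrassmannian permutations, i.e. those $\omega$ such that both $\omega$ and $\omega^{-1}$ have exactly one descent; equivalently $\omega=1\cdots a\,(b+1)\cdots c\,(a+1)\cdots b\,(c+1)\cdots n$ for some $0\le a<b<c\le n$. $\mathfrak{b}_n=|\mathfrak{B}_n|=\binom{n+1}{3}$. For $\omega\in\mathfrak{B}_n$, $\beta(\omega)$ is the number of $\pi\in\mathfrak{B}_n$ with $\pi\le\omega$, and $\alpha(\omega)$ is the number of $\tau\in\mathfrak{B}_n$ with $\omega\le\tau$. For $k\ge0$,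 $g_k(t)=\sum_{i\ge 0}i^kt^i$ with $0^0=1$, so that $g_k(te^{(1-t)u})=\sum_{i\ge0}i^kt^ie^{i(1-t)u}$ as a formal power series in $t,u$. $[t^{n+2}u^kv^\ell]G$ is the coefficient of $t^{n+2}u^kv^\ell$ in the formal power series $G$. $\mathbf{1}_{\{k=0\}}$ is $1$ if $k=0$ and $0$ otherwise. *)

(* Defs.v *)
From HB Require Import structures.
From mathcomp Require Import all_boot all_order all_algebra all_fingroup.
From mathcomp Require Import boolp.

Set Implicit Arguments.
Unset Strict Implicit.
Unset Printing Implicit Defensive.

Import Order.TTheory GRing.Theory Num.Theory.

Local Open Scope ring_scope.

(* Permutations of [n] are elements of 'S_n, on the indices 0, .., n - 1.     *)

(* Since (s * t) x = t (s x) in 'S_n, the product tperm i j * w is w with the *)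
(* values w i and w j interchanged.                                           *)
Definition reduction (n : nat) : rel 'S_n := fun w w' =>
  [exists i : 'I_n, exists j : 'I_n,
    [&& (i < j)%N, (w j < w i)%N & w' == (tperm i j * w)%g]].

Definition bruhat_le (n : nat) : rel 'S_n := fun p s =>
  connect (@reduction n) s p.

Definition descents (n : nat) (w : 'S_n) : {set 'I_n} :=
  [set i : 'I_n | [exists j : 'I_n, (val j == i.+1) && (w j < w i)%N]].

Definition bigrassmannian (n : nat) : {set 'S_n} :=
  [set w : 'S_n | (#|descents w| == 1%N) && (#|descents w^-1%g| == 1%N)].

Definition alpha (n : nat) (w : 'S_n) : nat :=
  #|[set x in bigrassmannian n | bruhat_le w x]|.

Definition beta (n : nat) (w : 'S_n) : nat :=
  #|[set p in bigrassmannian n | bruhat_le p w]|.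

(* Expectation of X under the uniform distribution on A (for A nonempty).     *)
Definition unif_expectation (T : finType) (A : {set T}) (X : T -> rat) : rat :=
  (\sum_(x in A) X x) / #|A|%:R.

Record fps (R : Type) := Fps { fpscoef : nat -> R }.

Lemma fpsP (R : Type) (f g : fps R) : fpscoef f =1 fpscoef g -> f = g.
Proof. by case: f g => [f] [g] /= /funext ->. Qed.

HB.instance Definition _ (R : Type) := gen_eqMixin (fps R).
HB.instance Definition _ (R : Type) := gen_choiceMixin (fps R).

Section FpsRing.
Variable R : comNzRingType.
Implicit Types f g h : fps R.

Definition fps_add f g := Fps (fun n => fpscoef f n + fpscoef g n).
Definition fps_opp f := Fps (fun n => - fpscoef f n).
Definition fps_mul f g :=
  Fps (fun n => \sum_(i < n.+1) fpscoef f i * fpscoef g (n - i)).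
Definition fpsC (c : R) := Fps (fun n => if n == 0%N then c else 0).
Definition fpsX : fps R := Fps (fun n => (n == 1%N)%:R).

Fact fps_addA : associative fps_add.
Proof. by move=> f g h; apply: fpsP => n /=; rewrite addrA. Qed.

Fact fps_addC : commutative fps_add.
Proof. by move=> f g; apply: fpsP => n /=; rewrite addrC. Qed.

Fact fps_add0 : left_id (fpsC 0) fps_add.
Proof. by move=> f; apply: fpsP => n /=; rewrite if_same add0r. Qed.

Fact fps_addN : left_inverse (fpsC 0) fps_opp fps_add.
Proof. by move=> f; apply: fpsP => n /=; rewrite if_same addNr. Qed.

HB.instance Definition _ := GRing.isZmodule.Build (fps R)
  fps_addA fps_addC fps_add0 fps_addN.

Fact fps_mulC : commutative fps_mul.
Proof.
move=> f g; apply: fpsP => n /=; rewrite (reindex_inj rev_ord_inj) /=.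
by apply: eq_bigr => i _; rewrite subSS subKn ?leq_ord // mulrC.
Qed.

Fact fps_mulA : associative fps_mul.
Proof.
move=> f g h; apply: fpsP => i; rewrite [fps_mul g h]fps_mulC /=.
rewrite [in RHS](reindex_inj rev_ord_inj) /=.
pose c j k := fpscoef f j * (fpscoef g (i - j - k) * fpscoef h k).
transitivity (\sum_(j < i.+1) \sum_(k < i.+1 | (k <= i - j)%N) c j k).
  apply: eq_bigr => /= j _; rewrite big_distrr /=.
  rewrite (big_ord_narrow_leq (leq_subr _ _)).
  by apply: eq_bigr => k _; rewrite [fpscoef h _ * _]mulrC.
rewrite (exchange_big_dep predT) //=; apply: eq_bigr => k _.
transitivity (\sum_(j < i.+1 | (j <= i - k)%N) c j k).
  apply: eq_bigl => j; rewrite -ltnS -(ltnS j) -!subSn ?leq_ord //.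
  by rewrite -subn_gt0 -(subn_gt0 j) -!subnDA addnC.
rewrite (big_ord_narrow_leq (leq_subr _ _)) subSS big_distrl /=.
apply: eq_bigr => j _; rewrite /c -!subnDA addnC mulrA.
by rewrite subnDA subKn ?leq_ord // addnC subnDA.
Qed.

Fact fps_mul1 : left_id (fpsC 1) fps_mul.
Proof.
move=> f; apply: fpsP => n /=; rewrite big_ord_recl subn0 mul1r.
by rewrite big1 ?addr0 // => i _; rewrite mul0r.
Qed.

Fact fps_mulDl : left_distributive fps_mul fps_add.
Proof.
move=> f g h; apply: fpsP => n /=; rewrite -big_split.
by apply: eq_bigr => i _; rewrite mulrDl.
Qed.

Fact fps_oner_neq0 : fpsC 1 != 0.
Proof.
apply/eqP => /(congr1 (fun f : fps R => fpscoef f 0)) /eqP.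
by rewrite /= oner_eq0.
Qed.

HB.instance Definition _ := GRing.Zmodule_isComNzRing.Build (fps R)
  fps_mulA fps_mulC fps_mul1 fps_mulDl fps_oner_neq0.

(* f^-1 is the multiplicative inverse of f if there is one, and f otherwise,  *)
(* as in every unitRingType.                                                  *)
Definition fps_unit : {pred fps R} := fun f => `[< exists g, g * f = 1 >].
Definition fps_inv f : fps R :=
  if pselect (exists g, g * f = 1) is left ex then projT1 (cid ex) else f.

Fact fps_mulVf : {in fps_unit, left_inverse 1 fps_inv *%R}.
Proof.
move=> f /asboolP ex; rewrite /fps_inv; case: pselect => // ex'.
by case: (cid ex').
Qed.

Fact fps_unitPl f g : g * f = 1 -> fps_unit f.
Proof. by move=> gf1; apply/asboolP; exists g. Qed.

Fact fps_inv_out : {in [predC fps_unit], fps_inv =1 id}.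
Proof.
move=> f nf; rewrite /fps_inv; case: pselect => // ex.
by case/negP: nf; apply/asboolP.
Qed.

HB.instance Definition _ := GRing.ComNzRing_hasMulInverse.Build (fps R)
  fps_mulVf fps_unitPl fps_inv_out.

Lemma fps_unit_1subX : 1 - fpsX \is a GRing.unit.
Proof.
apply: (@fps_unitPl _ (Fps (fun=> 1))).
apply: fpsP => n; rewrite mulrC /=; case: n => [|n].
  by rewrite big_ord1 /= subr0 mulr1.
by rewrite !big_ord_recl /= !mulr1 subr0 sub0r big1 ?addr0 ?subrr.
Qed.

End FpsRing.

(* Q[[v]][[u]][[t]], used as the ring of formal power series in t, u, v.      *)
Definition fps3 := fps (fps (fps rat)).
HB.instance Definition _ := GRing.ComUnitRing.on fps3.

Definition coef3 (F : fps3) (a b c : nat) : rat :=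
  fpscoef (fpscoef (fpscoef F a) b) c.

Definition var_t : fps3 := fpsX _.
Definition var_u : fps3 := fpsC (fpsX _).
Definition var_v : fps3 := fpsC (fpsC (fpsX _)).

(* The substitution f(h) = \sum_i f_i h^i, for h with zero constant term. The *)
(* terms with i > a + b + c do not contribute to the coefficient of           *)
(* t^a u^b v^c, because h^i has no monomial of total degree less than i.      *)
Definition fps_subst (f : fps rat) (h : fps3) : fps3 :=
  Fps (fun a => Fps (fun b => Fps (fun c =>
    \sum_(i < (a + b + c).+1) fpscoef f i * coef3 (h ^+ i) a b c))).

Definition fps_exp : fps rat := Fps (fun i => i`!%:R^-1).

(* In particular the constant term of gser 0 is 0 ^+ 0 = 1.                   *)
Definition gser (k : nat) : fps rat := Fps (fun i => i%:R ^+ k).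

(* g_k (t e^((1 - t) z)) *)
Definition gser_subst (k : nat) (z : fps3) : fps3 :=
  fps_subst (gser k) (var_t * fps_subst fps_exp ((1 - var_t) * z)).

(* Main.v *)
Require Import Defs.
From mathcomp Require Import all_boot all_order all_algebra all_fingroup.
From mathcomp Require Import zify ring.

(* Write w(a, b, c) for 1...a (b+1)...c (a+1)...b (c+1)...n. The Bruhat order is *)
(* monotone for the numbers #{x <= i, w x > j}, and moving one entry past       *)
(* smaller or larger ones is a chain of reductions. Hence w(a, b, c) <=         *)
(* w(a', b', c') iff a' <= a, c <= c', b - a <= b' - a' and c - b <= c' - b'.    *)
(* Counting with p = b - a, q = c - b, i = a + 1, j = n - c + 1 gives           *)
(* 2 beta = p q (p + q) and 2 alpha = i j (i + j), where (i, j, p, q) runs over  *)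
(* the compositions of n + 2. On the other side the coefficient of u^k in       *)
(* g_k(t e^((1-t)u))^2 / (1-t)^k, with the constant term of g_0 removed if k = 0, *)
(* is the sum over i, j >= 1 of (i j (i + j))^k t^(i+j) / k!,                    *)
(* because the exponentials multiply to e^((i+j)(1-t)u).                        *)

(** [bigrassmannianP] and [triple_perm_inj] put the bigrassmannian permutations in bijection with
    the triples a < b < c <= n, and [bruhat_block_perm] turns Bruhat comparison into four linear
    inequalities. Down-sets and up-sets are then lattice point counts of one shape, evaluated by
    [card_double_family]. On the analytic side, [is_egf] records the coefficients of z^b for z = u
    or z = v. The factor 1 - t in the exponent makes each of them carry exactly (1 - t)^b, which the
    denominator cancels at b = k and b = l. What is left is a Cauchy product in t
    ([moment_series_coef]). Its term of degree n + 2 is a sum over the splittings n + 2 = (i + j) +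
    (p + q), that is, over the permutations ([sum_bigrassmannian_moment]). *)

Set Implicit Arguments.
Unset Strict Implicit.
Unset Printing Implicit Defensive.

(** * Bruhat order on bigrassmannian permutations *)

(* 1...a (b+1)...c (a+1)...b (c+1)...n, with positions and values shifted to   *)
(* start at 0.                                                                *)
Definition block_swap (a b c x : nat) : nat :=
  if x < a then x else if x < a + (c - b) then x + (b - a)
  else if x < c then x - (c - b) else x.

(** Picking by values, with the identity as default, makes this total; it is only meaningful for a <
    b < c <= n. *)
Definition block_perm (n a b c : nat) : 'S_n :=
  odflt 1%g [pick w : 'S_n | [forall x, w x == block_swap a b c x :> nat]].

Ltac block_lia := rewrite /block_swap; repeat (case: ifP => ?); lia.

Lemma block_permE n a b c (x : 'I_n) : a < b < c -> c <= n ->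
  block_perm n a b c x = block_swap a b c x :> nat.
Proof.
move=> abc cn; rewrite /block_perm; case: pickP => [w /forallP /(_ x) /eqP //|].
have lt_n (y : 'I_n) : block_swap a b c y < n.
  by have := ltn_ord y; block_lia.
pose f y := Ordinal (lt_n y).
have f_inj : injective f.
  by move=> y z /(congr1 val) /= yz; apply: val_inj => /=; move: yz; block_lia.
move=> /(_ (perm f_inj)) /negP[]; apply/forallP => y.
by rewrite permE.
Qed.

Lemma block_permV n a b c : a < b < c -> c <= n ->
  ((block_perm n a b c)^-1 = block_perm n a (a + (c - b)) c)%g.
Proof.
move=> abc cn; apply/eqP; rewrite eq_invg_mul; apply/eqP/permP => x.
apply: val_inj; rewrite permM perm1 /= block_permE; [|lia..].
by have := block_permE x abc cn; move: (block_perm n a b c x) => y; block_lia.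
Qed.

(** * Rank counts and the necessary inequalities *)

Definition rank (n : nat) (w : 'S_n) (i j : nat) : nat :=
  \sum_(x < n) ((x < i) && (j <= w x)).

(** Only the terms at the two exchanged positions change, and there the larger value moves to the
    later position. *)
Lemma reduction_rank n (w w' : 'S_n) i j : reduction w w' -> rank w' i j <= rank w i j.
Proof.
case/existsP => x /existsP[y /and3P[xy wyx /eqP ->]].
have yx : y != x by rewrite neq_ltn xy orbT.
rewrite /rank (bigD1 x) // (bigD1 y) //= [leqRHS](bigD1 x) // [in leqRHS](bigD1 y) //=.
rewrite !permM tpermL tpermR !addnA; apply: leq_add.
  by case: (ltnP x i); case: (ltnP y i); case: (leqP j (w x)); case: (leqP j (w y)) => /=; lia.
apply: eq_leq; apply: eq_bigr => z /andP[zx zy].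
by rewrite permM tpermD // eq_sym.
Qed.

Lemma bruhat_rank n (p s : 'S_n) i j : bruhat_le p s -> rank p i j <= rank s i j.
Proof.
case/connectP => r; elim: r s => [s _ -> //|w r IH s /= /andP[sw wr] pE].
exact: leq_trans (IH _ wr pE) (reduction_rank _ _ sw).
Qed.

(* The four terms count the entries in the four blocks of the permutation.     *)
Lemma rank_block_perm n a b c i j : a < b < c -> c <= n -> i <= n ->
  rank (block_perm n a b c) i j =
  (minn i a - j) + (minn i (a + (c - b)) - maxn a (j - (b - a))) +
  (minn i c - maxn (a + (c - b)) (j + (c - b))) + (i - maxn c j).
Proof.
move=> abc cn i_n.
transitivity (\sum_(x < i) (j <= block_swap a b c x)).
  rewrite (big_ord_widen n (fun x => nat_of_bool (j <= block_swap a b c x)) i_n) big_mkcond.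
  by apply: eq_bigr => x _; rewrite block_permE //; case: ifP.
elim: i {i_n} => [|i IH]; first by rewrite big_ord0; lia.
rewrite big_ord_recr /= {}IH.
have count u v : minn i.+1 u - v = minn i u - v + ((i < u) && (v <= i)) by lia.
have count' v : i.+1 - v = i - v + (v <= i) by lia.
have -> : (j <= block_swap a b c i) = (((i < a) && (j <= i)) +
    ((i < a + (c - b)) && (maxn a (j - (b - a)) <= i)) +
    ((i < c) && (maxn (a + (c - b)) (j + (c - b)) <= i)) + (maxn c j <= i))%N :> nat.
  by block_lia.
rewrite !count count'; lia.
Qed.

(** Three ranks suffice. Those at (a + 1, a + 1) and (c - 1, c - 1) are positive for the smaller
    permutation, which forces a' <= a and c <= c'. At (a + (c - b), b) the block moved upwards
    contributes all its c - b entries, which bounds both block lengths. *)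
Lemma bruhat_block_perm_le n a b c a' b' c' : a < b < c -> c <= n -> a' < b' < c' -> c' <= n ->
  bruhat_le (block_perm n a b c) (block_perm n a' b' c') ->
  [/\ a' <= a, c <= c', b - a <= b' - a' & c - b <= c' - b'].
Proof.
move=> abc cn abc' cn' le.
have R i j : i <= n -> _ := fun H => bruhat_rank i j le.
have peak i j : i <= n -> minn i (a + (c - b)) - maxn a (j - (b - a)) <=
    rank (block_perm n a' b' c') i j.
  move=> i_n; apply: leq_trans (R i j i_n).
  by rewrite rank_block_perm // -addnA addnAC leq_addl.
have e1 : minn a.+1 (a + (c - b)) - maxn a (a.+1 - (b - a)) = 1 by clear -abc; lia.
have e2 : minn c.-1 (a + (c - b)) - maxn a (c.-1 - (b - a)) = 1 by clear -abc; lia.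
have e3 : minn (a + (c - b)) (a + (c - b)) - maxn a (b - (b - a)) = c - b by clear -abc; lia.
have := peak a.+1 a.+1; have := peak c.-1 c.-1; have := peak (a + (c - b)) b.
have [i1 i2 i3] : [/\ a + (c - b) <= n, c.-1 <= n & a < n] by clear -abc cn; split; lia.
rewrite e1 e2 e3 !rank_block_perm // => /(_ i1) r3 /(_ i2) r2 /(_ i3) r1.
have aa : a' <= a by clear -r1 abc abc'; lia.
have cc : c <= c' by clear -r2 abc abc'; lia.
clear r1 r2 e1 e2 e3 i1 i2 i3 peak le R cn cn'.
by split=> //; lia.
Qed.

(** A single reduction in continuation form. Permutations enter through functions on [nat], so that
    the side conditions are pure arithmetic. *)
Lemma bruhat_step n (w : 'S_n) (f f' : nat -> nat) (i j : nat) p :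
  (forall x : 'I_n, w x = f x :> nat) -> i < j < n -> f j < f i ->
  f' i = f j -> f' j = f i -> (forall x, x != i -> x != j -> f' x = f x) ->
  (forall w' : 'S_n, (forall x : 'I_n, w' x = f' x :> nat) -> bruhat_le p w') ->
  bruhat_le p w.
Proof.
move=> wf /andP[ij jn] fji fi fj fx le.
pose i' := Ordinal (ltn_trans ij jn); pose j' := Ordinal jn.
apply: (@connect_trans _ _ (tperm i' j' * w)%g); last first.
  apply: le => x; rewrite permM wf.
  case: tpermP => [->|->|/eqP xi /eqP xj] //=; apply/esym/fx.
    by rewrite -(inj_eq val_inj) in xi.
  by rewrite -(inj_eq val_inj) in xj.
apply/connect1/existsP; exists i'; apply/existsP; exists j'.
by rewrite !wf /= ij fji eqxx.
Qed.

Lemma eq_perm_nat n (w w' : 'S_n) (f f' : nat -> nat) :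
  (forall x : 'I_n, w x = f x :> nat) -> (forall x : 'I_n, w' x = f' x :> nat) ->
  (forall x, f x = f' x) -> w = w'.
Proof. by move=> wf wf' ff; apply/permP => x; apply: val_inj; rewrite /= wf wf' ff. Qed.

Ltac if_lia := repeat (case: ifP => /eqP ?); lia.

(* The entry at position s moves right past the smaller entries at positions   *)
(* t, .., t + d, which may be separated from s by a gap.                       *)
Lemma bruhat_move_right n (w w' : 'S_n) (f f' : nat -> nat) s t d :
  (forall x : 'I_n, w x = f x :> nat) -> (forall x : 'I_n, w' x = f' x :> nat) ->
  s < t -> t + d < n -> (forall y, t <= y <= t + d -> f y < f s) ->
  f' s = f t -> (forall y, t <= y < t + d -> f' y = f y.+1) -> f' (t + d) = f s ->
  (forall x, x != s -> (x < t) || (t + d < x) -> f' x = f x) ->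
  bruhat_le w' w.
Proof.
move=> + wf'; elim: d s t f w => [|d IH] s t f w wf st tn lt_s f's f'y f't f'x;
  pose g x := if x == s then f t else if x == t then f s else f x.
  apply: (@bruhat_step n w f g s t) => //; rewrite /g ?eqxx //.
  - by rewrite st -(addn0 t).
  - by apply: lt_s; lia.
  - if_lia.
  - by move=> x /negbTE -> /negbTE ->.
  have fg x : f' x = g x.
    rewrite addn0 in f't; rewrite /g.
    case: ifP => [/eqP -> //|/negbT xs]; case: ifP => [/eqP -> //|/negbT xt].
    by apply: f'x; lia.
  by move=> v vg; rewrite (eq_perm_nat wf' vg fg) /bruhat_le connect0.
apply: (@bruhat_step n w f g s t) => //; rewrite /g ?eqxx //.
- by rewrite st; lia.
- by apply: lt_s; lia.
- if_lia.
- by move=> x /negbTE -> /negbTE ->.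
move=> v vg; apply: (IH t t.+1 g v) => //; rewrite /g.
- lia.
- by move=> y ty; have := lt_s y; if_lia.
- by rewrite f'y; if_lia.
- by move=> y ty; rewrite f'y; if_lia.
- by rewrite addSnnS f't; if_lia.
- move=> x xt; case: ifP => [/eqP -> //|/negbT xs]; rewrite (negbTE xt) => ?.
  by apply: f'x => //; lia.
Qed.

(** Mirror image of [bruhat_move_right]: the entry at t moves left past larger entries. The first
    exchange is with s + d, across the possible gap, so the induction removes the right end of the
    range. *)
Lemma bruhat_move_left n (w w' : 'S_n) (f f' : nat -> nat) s t d :
  (forall x : 'I_n, w x = f x :> nat) -> (forall x : 'I_n, w' x = f' x :> nat) ->
  s + d < t -> t < n -> (forall y, s <= y <= s + d -> f t < f y) ->
  f' s = f t -> (forall y, s <= y < s + d -> f' y.+1 = f y) -> f' t = f (s + d) ->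
  (forall x, x != t -> (x < s) || (s + d < x) -> f' x = f x) ->
  bruhat_le w' w.
Proof.
move=> + wf'; elim: d t f w => [|d IH] t f w wf st tn lt_s f's f'y f't f'x.
  pose g x := if x == s then f t else if x == t then f s else f x.
  rewrite addn0 in st f't; apply: (@bruhat_step n w f g s t) => //; rewrite /g ?eqxx //.
  - by rewrite st.
  - by apply: lt_s; lia.
  - if_lia.
  - by move=> x /negbTE -> /negbTE ->.
  have fg x : f' x = g x.
    rewrite /g; case: ifP => [/eqP -> //|/negbT xs]; case: ifP => [/eqP -> //|/negbT xt].
    by apply: f'x; lia.
  by move=> v vg; rewrite (eq_perm_nat wf' vg fg) /bruhat_le connect0.
pose g x := if x == s + d.+1 then f t else if x == t then f (s + d.+1) else f x.
apply: (@bruhat_step n w f g (s + d.+1) t) => //; rewrite /g ?eqxx //.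
- by rewrite st.
- by apply: lt_s; lia.
- if_lia.
- by move=> x /negbTE -> /negbTE ->.
move=> v vg; apply: (IH (s + d.+1) g v) => //; rewrite /g.
- lia.
- lia.
- by move=> y ty; have := lt_s y; if_lia.
- by rewrite f's; if_lia.
- by move=> y ty; rewrite f'y; if_lia.
- by rewrite addnS f'y; if_lia.
- move=> x xt xs; rewrite (negbTE xt); case: ifP => [/eqP -> //|/negbT xt'].
  by apply: f'x => //; lia.
Qed.

(** Each of the four moves raises a or lowers c by one and shortens exactly one of the blocks by
    one. Each is a sweep of one extreme entry of a block past the whole other block. *)
Section UnitSteps.
Variables n a b c : nat.
Hypotheses (abc : a < b < c) (cn : c <= n).

Let w : 'S_n := block_perm n a b c.
Let wE x : w x = block_swap a b c x :> nat. Proof. exact: block_permE. Qed.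

Lemma bruhat_step_a : a.+1 < b -> bruhat_le (block_perm n a.+1 b c) w.
Proof.
move=> ab; apply: (@bruhat_move_left _ _ _ _ (block_swap a.+1 b c) a (a + (c - b)) (c - b).-1 wE).
- by move=> x; apply: block_permE; lia.
all: try by [lia | move=> ? ?; block_lia | block_lia].
Qed.

Lemma bruhat_step_c : b < c.-1 -> bruhat_le (block_perm n a b c.-1) w.
Proof.
move=> bc; apply: (@bruhat_move_right _ _ _ _ (block_swap a b c.-1)
  (a + (c - b)).-1 (a + (c - b)) (b - a).-1 wE).
- by move=> x; apply: block_permE; lia.
all: try by [lia | move=> ? ?; block_lia | block_lia].
Qed.

Lemma bruhat_step_ab : b.+1 < c -> bruhat_le (block_perm n a.+1 b.+1 c) w.
Proof.
move=> bc; apply: (@bruhat_move_right _ _ _ _ (block_swap a.+1 b.+1 c)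
  a (a + (c - b)) (b - a).-1 wE).
- by move=> x; apply: block_permE; lia.
all: try by [lia | move=> ? ?; block_lia | block_lia].
Qed.

Lemma bruhat_step_bc : a < b.-1 -> bruhat_le (block_perm n a b.-1 c.-1) w.
Proof.
move=> ab; apply: (@bruhat_move_left _ _ _ _ (block_swap a b.-1 c.-1)
  a c.-1 (c - b).-1 wE).
- by move=> x; apply: block_permE; lia.
all: try by [lia | move=> ? ?; block_lia | block_lia].
Qed.

End UnitSteps.

(** Induction on (a - a') + (c' - c). If this is positive then c' - a' > c - a, so one of the two
    blocks is strictly longer in the larger permutation, and the unit step shortening that block
    keeps all four inequalities. *)
Lemma bruhat_block_perm_ge n a b c a' b' c' :
  a < b < c -> c <= n -> a' < b' < c' -> c' <= n ->
  [&& a' <= a, c <= c', b + a' <= b' + a & c + b' <= c' + b] ->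
  bruhat_le (block_perm n a b c) (block_perm n a' b' c').
Proof.
move=> abc cn; have [m] := ubnP (a + c' - (a' + c)).
elim: m a' b' c' => // m IH a' b' c' lt_m abc' cn' le.
have trans v : bruhat_le v (block_perm n a' b' c') ->
    bruhat_le (block_perm n a b c) v ->
    bruhat_le (block_perm n a b c) (block_perm n a' b' c').
  exact: connect_trans.
have [aa|aa] := ltnP a' a.
  have [q|q] := ltnP (b + a') (b' + a).
    by apply: trans (bruhat_step_a _ _ _) _; [..|apply: IH]; clear -abc abc' cn cn' lt_m le aa q; lia.
  by apply: trans (bruhat_step_ab _ _ _) _; [..|apply: IH]; clear -abc abc' cn cn' lt_m le aa q; lia.
have [cc|cc] := ltnP c c'.
  have [q|q] := ltnP (b + a') (b' + a).
    by apply: trans (bruhat_step_bc _ _ _) _; [..|apply: IH]; clear -abc abc' cn cn' lt_m le aa q cc; lia.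
  by apply: trans (bruhat_step_c _ _ _) _; [..|apply: IH]; clear -abc abc' cn cn' lt_m le aa q cc; lia.
have [-> -> ->] : [/\ a' = a, b' = b & c' = c] by clear -le aa cc; split; lia.
exact: connect0.
Qed.

Lemma bruhat_block_perm n a b c a' b' c' :
  a < b < c -> c <= n -> a' < b' < c' -> c' <= n ->
  bruhat_le (block_perm n a b c) (block_perm n a' b' c') =
  [&& a' <= a, c <= c', b - a <= b' - a' & c - b <= c' - b'].
Proof.
move=> abc cn abc' cn'; apply/idP/idP => [le|le].
  by apply/and4P; apply: bruhat_block_perm_le le.
by apply: bruhat_block_perm_ge => //; clear -abc abc' le; lia.
Qed.

(** * Descents and the classification of bigrassmannian permutations *)

Lemma card_descents_block_perm n a b c : a < b < c -> c <= n ->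
  #|descents (block_perm n a b c)| = 1.
Proof.
move=> abc cn; have lt_n : (a + (c - b)).-1 < n by lia.
rewrite (_ : descents _ = [set Ordinal lt_n]) ?cards1 //.
apply/setP => i; rewrite !inE -(inj_eq val_inj) /=.
apply/existsP/eqP => [[j /andP[/eqP ji]]|iE].
  by rewrite !block_permE // ji; block_lia.
have lt_n' : a + (c - b) < n by lia.
exists (Ordinal lt_n'); rewrite !block_permE //= iE.
by apply/andP; split; [lia | block_lia].
Qed.

Lemma block_perm_bigrassmannian n a b c : a < b < c -> c <= n ->
  block_perm n a b c \in bigrassmannian n.
Proof.
move=> abc cn; rewrite inE block_permV // !card_descents_block_perm //; lia.
Qed.

Lemma single_descentP n (w : 'S_n) : #|descents w| = 1 ->
  exists2 i : 'I_n, exists2 j : 'I_n, j = i.+1 :> nat & w j < w i &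
    forall x y : 'I_n, x < y -> (y <= i) || (i < x) -> w x < w y.
Proof.
move=> /eqP/cards1P[i dE]; have : i \in descents w by rewrite dE set11.
rewrite inE => /existsP[j /andP[/eqP ji wji]].
exists i; first by exists j.
move=> x y; have [d] := ubnP (y - x); elim: d y => // d IH y lt_d xy xyi.
have lt_n : y.-1 < n by have := ltn_ord y; lia.
pose z := Ordinal lt_n; have zE : z = y.-1 :> nat by [].
have wzy : w z < w y.
  rewrite ltn_neqAle; apply/andP; split.
    by apply/eqP => /val_inj/perm_inj zy; rewrite zy in zE; lia.
  rewrite leqNgt; apply/negP => wyz.
  have : z \in descents w.
    by rewrite inE; apply/existsP; exists y; apply/andP; split=> //=; lia.
  by rewrite dE inE => /eqP zi; rewrite zi in zE; lia.
have [xz|zx] := ltnP x z; last by rewrite (_ : x = z) //; apply: val_inj => /=; lia.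
by apply: ltn_trans wzy; apply: IH => //=; lia.
Qed.

(** Supplies the thresholds a and c in [bigrassmannianP]. *)
Lemma decreasing_predP (P : pred nat) lo hi : lo <= hi ->
  (forall x y, lo <= x < y -> y < hi -> P y -> P x) ->
  exists2 a, lo <= a <= hi & forall x, lo <= x < hi -> P x = (x < a).
Proof.
move=> /subnKC <-; elim: (hi - lo) => [|d IH] decr.
  by exists lo => [|x]; rewrite ?addn0; lia.
have [x y xy yd|a ad aP] := IH; first by apply: decr; lia.
have [Pd|Pd] := boolP (P (lo + d)).
  exists (lo + d.+1) => [|x x_le]; first by lia.
  have [->|xd] := eqVneq x (lo + d); first by rewrite Pd; lia.
  by rewrite (decr x (lo + d)) //; lia.
exists a => [|x x_le]; first by lia.
have [xE|xd] := eqVneq x (lo + d); last by rewrite aP //; lia.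
by rewrite xE (negbTE Pd); lia.
Qed.

Lemma perm_val_count n (w : 'S_n) x : w x = \sum_(y < n) (w y < w x) :> nat.
Proof.
have count m k : \sum_(v < m) (v < k) = minn m k.
  by elim: m => [|m IH]; rewrite ?big_ord0 ?big_ord_recr /= ?IH; lia.
rewrite -(reindex_inj (@perm_inj _ w) (P := predT) (F := fun v : 'I_n => nat_of_bool (v < w x))).
by rewrite count; have := ltn_ord (w x); lia.
Qed.

Lemma count_interval m u t : \sum_(y < m) (u <= y < t) = minn m t - u.
Proof. by elim: m => [|m IH]; rewrite ?big_ord0 ?big_ord_recr /= ?IH; lia. Qed.

(* The unique descents of [w] and of its inverse split positions and values  *)
(* into two intervals each. An entry is the number of smaller entries, which *)
(* is read off from the set of positions carrying values in the lower one.   *)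
Lemma bigrassmannianP n (w : 'S_n) : w \in bigrassmannian n ->
  exists a b c, [/\ a < b < c, c <= n & w = block_perm n a b c].
Proof.
rewrite inE => /andP[/eqP/single_descentP[i [j ji wji] w_incr]].
move=> /eqP/single_descentP[v _ winv_incr].
(* The inverse increases on the values up to v and on those above v, so entries on the same side of
   v are ordered like their positions. *)
have order x y : (w x <= v) = (w y <= v) -> (w x < w y) = (x < y).
  have incr x' y' : w x' < w y' -> (w x' <= v) = (w y' <= v) -> x' < y'.
    move=> lt_w side; have := winv_incr _ _ lt_w; rewrite !permK; apply.
    by rewrite -side ltnNge orbN.
  move=> side; case: (ltngtP (w x) (w y)) => [lt_w|lt_w|/val_inj/perm_inj ->].
  - by rewrite incr.
  - by apply/esym; rewrite ltnNge ltnW // incr.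
  - by rewrite ltnn.
pose P x := [exists y : 'I_n, (y == x :> nat) && (w y <= v)].
have PE (x : 'I_n) : P x = (w x <= v).
  apply/existsP/idP => [[y /andP[/eqP/val_inj -> //]]|wx].
  by exists x; rewrite eqxx.
have decr lo hi : (hi <= j) || (j <= lo) -> hi <= n ->
    forall x y, lo <= x < y -> y < hi -> P y -> P x.
  move=> lohi hin x y xy yhi.
  have yn := leq_trans yhi hin; have xn : x < n by lia.
  have := PE (Ordinal xn); have := PE (Ordinal yn) => /= -> ->.
  by apply: leq_trans; apply/ltnW/w_incr => //=; lia.
have jn := ltn_ord j; have j0 : 0 < j by rewrite ji.
have lower : (j <= j) || (j <= 0) by rewrite leqnn.
have upper : (n <= j) || (j <= j) by rewrite leqnn orbT.
(* As w increases on [0, j) and on [j, n), the values <= v come first in each interval, up to a and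
   c respectively. *)
have [a aj aP] := decreasing_predP (leq0n j) (decr 0 j lower (ltnW jn)).
have [c jc cP] := decreasing_predP (ltnW jn) (decr j n upper (leqnn n)).
have Pval (x : 'I_n) : (w x <= v) = (x < a) || (j <= x < c).
  rewrite -PE; have [xj|jx] := ltnP x j; first by rewrite aP //; lia.
  by rewrite cP; have := ltn_ord x; lia.
have ij_sides : (w i <= v) != (w j <= v).
  by apply/negP => /eqP side; move: wji; rewrite order // ji ltnNge leqnSn.
have abc : a < j < c.
  have [wi wj] : (w i <= v) = false /\ w j <= v by clear -ij_sides wji; lia.
  move: wi wj; rewrite !Pval leqnn /=; clear -aj ji; lia.
(* The positions a, .., j - 1 carry the block moved upwards, so b is determined by c - b = j - a. *)
exists a, (a + (c - j)), c; split; [lia | lia | ].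
apply/permP => x; apply: val_inj; rewrite /= perm_val_count block_permE; [|lia|lia].
have xn := ltn_ord x.
case wx : (w x <= v).
  transitivity (\sum_(y < n) ((0 <= y < minn x a) + (j <= y < minn x c))).
    apply: eq_bigr => y _; have := Pval y; case wy : (w y <= v).
      by rewrite order ?wx ?wy //; clear -abc; lia.
    have -> : w y < w x = false by clear -wx wy; lia.
    by clear -abc; lia.
  rewrite big_split !count_interval /=; move: wx; rewrite Pval.
  by clear -abc xn; block_lia.
(* For w x above v, the smaller entries are all those before x, together with the later ones of
   value <= v. *)
transitivity (\sum_(y < n) ((0 <= y < x) + (x <= y < a) + (maxn x j <= y < c))).
  apply: eq_bigr => y _; have := Pval y; case wy : (w y <= v).
    have -> : w y < w x by clear -wx wy; lia.
    by clear -abc; lia.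
  by rewrite order ?wx ?wy //; clear -abc; lia.
rewrite !big_split !count_interval /=; move: wx; rewrite Pval.
by clear -abc jc xn; block_lia.
Qed.

(** * Counting *)

Lemma uniq_allpairs_dep (S T R : eqType) (f : S -> T -> R) (s : seq S) (t : S -> seq T) :
  uniq s -> (forall x, uniq (t x)) ->
  (forall x y x' y', x \in s -> y \in t x -> x' \in s -> y' \in t x' ->
    f x y = f x' y' -> (x, y) = (x', y')) ->
  uniq [seq f x y | x <- s, y <- t x].
Proof.
move=> us ut f_inj; apply: allpairs_uniq_dep us (fun x _ => ut x) _ => xy xy'.
case/allpairsPdep => x [y [sx ty ->]] /allpairsPdep[x' [y' [sx' ty' ->]]] /=.
by case/(f_inj _ _ _ _ sx ty sx' ty') => -> ->.
Qed.

Definition triple_valid (n : nat) (t : nat * nat * nat) : bool :=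
  (t.1.1 < t.1.2 < t.2) && (t.2 <= n).

Definition triple_perm (n : nat) (t : nat * nat * nat) : 'S_n :=
  block_perm n t.1.1 t.1.2 t.2.

(** Equal permutations are comparable both ways, and the four inequalities are antisymmetric in the
    triples. *)
Lemma triple_perm_inj n : {in triple_valid n &, injective (triple_perm n)}.
Proof.
move=> [[a b] c] [[a' b'] c'] /andP[/= abc cn] /andP[/= abc' cn'] E.
have := bruhat_block_perm abc cn abc' cn'; have := bruhat_block_perm abc' cn' abc cn.
rewrite -[block_perm n a b c]/(triple_perm n (a, b, c)) E /bruhat_le connect0.
move=> le1 le2; have [-> -> ->] // : [/\ a = a', b = b' & c = c'].
by clear -le1 le2 abc abc'; split; lia.
Qed.

Lemma big_bigrassmannian (T : Type) (idx : T) (op : Monoid.com_law idx) n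
    (A : pred 'S_n) (s : seq (nat * nat * nat)) (F : 'S_n -> T) :
  uniq s -> (forall t, (t \in s) = triple_valid n t && A (triple_perm n t)) ->
  \big[op/idx]_(w in bigrassmannian n | A w) F w = \big[op/idx]_(t <- s) F (triple_perm n t).
Proof.
move=> us sP; rewrite -(big_map (triple_perm n) predT) big_uniq.
  apply: eq_bigl => w; apply/andP/mapP => [[/bigrassmannianP[a [b [c [abc cn ->]]]] Aw]|].
    by exists (a, b, c) => //; rewrite sP /triple_valid /= abc cn.
  by case=> t; rewrite sP => /andP[/andP[abc cn] At] ->; rewrite block_perm_bigrassmannian.
rewrite map_inj_in_uniq // => t t'; rewrite !sP => /andP[t1 _] /andP[t2 _].
exact: triple_perm_inj.
Qed.

Lemma double_sum X Y :
  (\sum_(0 <= x < X) \sum_(0 <= y < Y) (x + y).+1) * 2 = X * Y * (X + Y).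
Proof.
have inner x : (\sum_(0 <= y < Y) (x + y).+1) * 2 = Y * (x * 2 + Y + 1).
  elim: Y => [|Y IH]; first by rewrite big_geq.
  by rewrite big_nat_recr //= mulnDl IH; ring.
elim: X => [|X IH]; first by rewrite big_geq.
by rewrite big_nat_recr //= mulnDl IH inner; ring.
Qed.

(** Common shape of the counts for [alpha] and [beta]: two free parameters x, y and a third one with
    x + y + 1 choices, so that [double_sum] applies. *)
Lemma card_double_family n (A : {set 'S_n}) X Y (h : nat * nat -> nat -> nat * nat * nat) lo :
  A \subset bigrassmannian n ->
  (forall x y x' y' z z', x < X -> y < Y -> x' < X -> y' < Y ->
     h (x, y) z = h (x', y') z' -> [/\ x = x', y = y' & z = z']) ->
  (forall t, reflect (exists x y z, [/\ x < X, y < Y, lo x y <= z < lo x y + (x + y).+1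
                      & t = h (x, y) z])
             (triple_valid n t && (triple_perm n t \in A))) ->
  #|A| * 2 = X * Y * (X + Y).
Proof.
move=> AB h_inj hP; rewrite -double_sum; congr (_ * 2).
pose s := [seq h xy z | xy <- [seq (x, y) | x <- index_iota 0 X, y <- index_iota 0 Y],
                        z <- index_iota (lo xy.1 xy.2) (lo xy.1 xy.2 + (xy.1 + xy.2).+1)].
transitivity (\sum_(w in bigrassmannian n | w \in A) 1).
  rewrite -sum1_card; apply: eq_bigl => w.
  by case: (boolP (w \in A)) => [/(subsetP AB) ->|]; rewrite ?andbF.
rewrite (@big_bigrassmannian _ _ _ n _ s).
- rewrite big_allpairs_dep big_allpairs_dep; apply: eq_bigr => x _; apply: eq_bigr => y _.
  by rewrite sum1_size size_iota addKn.
- apply: uniq_allpairs_dep => [|xy|[x y] z [x' y'] z'].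
  + by apply: allpairs_uniq; rewrite ?iota_uniq // => -[? ?] [? ?].
  + exact: iota_uniq.
  case/allpairsP => -[x1 y1] [/= x1X y1Y [-> ->]] _.
  case/allpairsP => -[x2 y2] [/= x2X y2Y [-> ->]] _ hE.
  rewrite !mem_index_iota in x1X y1Y x2X y2Y.
  by have [-> -> ->] := h_inj _ _ _ _ _ _ x1X y1Y x2X y2Y hE.
move=> t; apply/allpairsPdep/hP => [[[x y] [z [/allpairsP[[x1 y1] [/= xX yY [-> ->]]] zlo ->]]]|].
  by exists x1, y1, z; rewrite /= mem_index_iota in zlo; rewrite !mem_index_iota in xX yY.
move=> [x [y [z [xX yY zlo ->]]]]; exists (x, y), z; rewrite /= mem_index_iota; split=> //.
by apply/allpairsP; exists (x, y); rewrite !mem_index_iota.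
Qed.

Lemma beta_block_perm n a b c : a < b < c -> c <= n ->
  beta (block_perm n a b c) * 2 = (b - a) * (c - b) * ((b - a) + (c - b)).
Proof.
move=> abc cn; rewrite /beta.
(* x and y are the losses in the two block lengths and z is the new a; the bound c' <= c means z <=
   a + x + y. *)
apply: (card_double_family (h := fun xy z => (z, z + (b - a - xy.1), z + (b - a - xy.1) + (c - b - xy.2)))
  (lo := fun _ _ => a)).
- by apply/subsetP => w; rewrite inE => /andP[].
- by move=> x y x' y' z z' xX yY xX' yY' /= [zz bb cc]; split; lia.
move=> [[a' b'] c']; apply: (iffP idP) => [|[x [y [z [xX yY zlo [-> -> ->]]]]]].
  rewrite inE => /and3P[/andP[/= abc' cn'] _]; rewrite bruhat_block_perm //= => /and4P[l1 l2 l3 l4].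
  exists (b - a - (b' - a')), (c - b - (c' - b')), a'; split; try lia.
  by congr (_, _, _); lia.
have abc' : z < z + (b - a - x) < z + (b - a - x) + (c - b - y) by lia.
have cn' : z + (b - a - x) + (c - b - y) <= n by lia.
rewrite inE /triple_perm /= block_perm_bigrassmannian // bruhat_block_perm //.
by rewrite /triple_valid /= abc' cn' /=; lia.
Qed.

Lemma alpha_block_perm n a b c : a < b < c -> c <= n ->
  alpha (block_perm n a b c) * 2 = a.+1 * (n - c).+1 * (a.+1 + (n - c).+1).
Proof.
move=> abc cn; rewrite /alpha.
(* x and y tell how far a drops and c grows; the block lengths confine the new b, which is z, to b -
   x, .., b + y. *)
apply: (card_double_family (h := fun xy z => (a - xy.1, z, c + xy.2))
  (lo := fun x _ => a - x + (b - a))).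
- by apply/subsetP => w; rewrite inE => /andP[].
- by move=> x y x' y' z z' xX yY xX' yY' /= [zz bb cc]; split; lia.
move=> [[a' b'] c']; apply: (iffP idP) => [|[x [y [z [xX yY zlo [-> -> ->]]]]]].
  rewrite inE => /and3P[/andP[/= abc' cn'] _]; rewrite bruhat_block_perm //= => /and4P[l1 l2 l3 l4].
  exists (a - a'), (c' - c), b'; split; try lia.
  by congr (_, _, _); lia.
have abc' : a - x < z < c + y by lia.
have cn' : c + y <= n by lia.
rewrite inE /triple_perm /= block_perm_bigrassmannian // bruhat_block_perm //.
by rewrite /triple_valid /= abc' cn' /=; lia.
Qed.

(** * Coefficient extraction *)

Import Order.TTheory GRing.Theory Num.Theory.
Local Open Scope ring_scope.

Lemma fpscoefD (R : comNzRingType) (f g : fps R) i :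
  fpscoef (f + g) i = fpscoef f i + fpscoef g i.
Proof. by []. Qed.

Lemma fpscoefN (R : comNzRingType) (f : fps R) i :
  fpscoef (- f) i = - fpscoef f i.
Proof. by []. Qed.

Lemma fpscoef0 (R : comNzRingType) i : fpscoef (0 : fps R) i = 0.
Proof. by rewrite /= if_same. Qed.

Lemma fpscoef1 (R : comNzRingType) i : fpscoef (1 : fps R) i = (i == 0%N)%:R.
Proof. by rewrite /=; case: eqP. Qed.

Lemma fpscoefM (R : comNzRingType) (f g : fps R) i :
  fpscoef (f * g) i = \sum_(j < i.+1) fpscoef f j * fpscoef g (i - j).
Proof. by []. Qed.

Lemma fpscoef_sum (R : comNzRingType) (I : Type) (r : seq I) (P : pred I)
    (F : I -> fps R) i :
  fpscoef (\sum_(x <- r | P x) F x) i = \sum_(x <- r | P x) fpscoef (F x) i.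
Proof.
apply: (big_morph (fun f : fps R => fpscoef f i)) => [f g|].
  exact: fpscoefD.
exact: fpscoef0.
Qed.

Lemma fpscoefMn (R : comNzRingType) (f : fps R) m i :
  fpscoef (f *+ m) i = fpscoef f i *+ m.
Proof.
elim: m => [|m IH]; first by rewrite !mulr0n fpscoef0.
by rewrite !mulrS fpscoefD IH.
Qed.

Lemma fpscoef_natM (R : comNzRingType) m (f : fps R) i :
  fpscoef (m%:R * f) i = m%:R * fpscoef f i.
Proof. by rewrite !mulr_natl fpscoefMn. Qed.

Lemma fpscoefXM (R : comNzRingType) (f : fps R) i :
  fpscoef (fpsX R * f) i = if i == 0%N then 0 else fpscoef f i.-1.
Proof.
case: i => [|i]; rewrite fpscoefM; first by rewrite big_ord1 /= mul0r.
rewrite !big_ord_recl big1 => [|j _] /=; last by rewrite mul0r.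
by rewrite mul0r mul1r add0r addr0 subSS subn0.
Qed.

Lemma fpscoefXnM (R : comNzRingType) m (f : fps R) i :
  fpscoef (fpsX R ^+ m * f) i = if (i < m)%N then 0 else fpscoef f (i - m).
Proof.
elim: m i => [|m IH] i; first by rewrite expr0 mul1r subn0.
by rewrite exprS -mulrA fpscoefXM IH; case: i.
Qed.

Lemma fpscoef_natb (R : comNzRingType) (x : bool) i :
  fpscoef (x%:R : fps R) i = ((i == 0%N) && x)%:R.
Proof.
by case: x; rewrite ?andbT ?andbF ?mulr1n ?fpscoef1 // mulr0n fpscoef0.
Qed.

(** * Coefficients of series in t, u and v *)

Lemma coef3M (F G : fps3) a b c :
  coef3 (F * G) a b c =
  \sum_(i < a.+1) \sum_(j < b.+1) \sum_(m < c.+1)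
    coef3 F i j m * coef3 G (a - i) (b - j) (c - m).
Proof.
rewrite /coef3 fpscoefM !fpscoef_sum; apply: eq_bigr => i _.
by rewrite fpscoefM fpscoef_sum.
Qed.

Lemma coef3_1 a b c :
  coef3 1 a b c = [&& a == 0%N, b == 0%N & c == 0%N]%:R.
Proof.
by rewrite /coef3 fpscoef1 fpscoef_natb fpscoef_natb andbC (andbC (b == _)) andbA.
Qed.

(* The flag [sw] exchanges the roles of the variables u and v. *)
Definition tcoef (sw : bool) (F : fps3) (b c : nat) : fps rat :=
  Fps (fun a => if sw then coef3 F a c b else coef3 F a b c).

Definition var_uv (sw : bool) : fps3 := if sw then var_v else var_u.

Lemma tcoefM sw F G b c :
  tcoef sw (F * G) b c =
  \sum_(j < b.+1) \sum_(m < c.+1) tcoef sw F j m * tcoef sw G (b - j) (c - m).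
Proof.
apply: fpsP => a; rewrite fpscoef_sum.
under [RHS]eq_bigr => j _ do rewrite fpscoef_sum.
case: sw; rewrite [LHS]/= coef3M.
  rewrite [RHS]exchange_big [LHS]exchange_big; apply: eq_bigr => j _.
  by rewrite exchange_big.
rewrite [LHS]exchange_big; apply: eq_bigr => j _.
by rewrite exchange_big.
Qed.

Lemma tcoefD sw F G b c : tcoef sw (F + G) b c = tcoef sw F b c + tcoef sw G b c.
Proof. by apply: fpsP => a /=; case: sw. Qed.

Lemma tcoefN sw F b c : tcoef sw (- F) b c = - tcoef sw F b c.
Proof. by apply: fpsP => a /=; case: sw. Qed.

Lemma tcoef0 sw b c : tcoef sw 0 b c = 0.
Proof. by rewrite -[0](subrr 1) tcoefD tcoefN subrr. Qed.

Lemma tcoef1 sw b c : tcoef sw 1 b c = ((b == 0%N) && (c == 0%N))%:R.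
Proof.
apply: fpsP => a; rewrite /tcoef [LHS]/= !coef3_1.
by rewrite fpscoef_natb; case: sw; rewrite // (andbC (c == _)).
Qed.

Lemma tcoef_tM sw F b c : tcoef sw (var_t * F) b c = fpsX _ * tcoef sw F b c.
Proof.
apply: fpsP => a; rewrite fpscoefXM /tcoef /= /coef3 /var_t fpscoefXM.
by case: sw; case: eqP => // _; rewrite !fpscoef0.
Qed.

Lemma tcoef_tXM sw m F b c :
  tcoef sw (var_t ^+ m * F) b c = fpsX _ ^+ m * tcoef sw F b c.
Proof.
elim: m => [|m IH]; first by rewrite !expr0 !mul1r.
by rewrite !exprS -!mulrA tcoef_tM IH.
Qed.

Lemma tcoef_1subtM sw F b c :
  tcoef sw ((1 - var_t) * F) b c = (1 - fpsX _) * tcoef sw F b c.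
Proof. by rewrite !mulrBl !mul1r tcoefD tcoefN tcoef_tM. Qed.

Lemma tcoef_1subtXM sw m F b c :
  tcoef sw ((1 - var_t) ^+ m * F) b c = (1 - fpsX _) ^+ m * tcoef sw F b c.
Proof.
elim: m => [|m IH]; first by rewrite !expr0 !mul1r.
by rewrite !exprS -!mulrA tcoef_1subtM IH.
Qed.

Lemma fpscoefCM (R : comNzRingType) (x : R) (f : fps R) i :
  fpscoef (fpsC x * f) i = x * fpscoef f i.
Proof.
rewrite fpscoefM big_ord_recl big1 => [|j _]; last by rewrite /= mul0r.
by rewrite addr0 subn0.
Qed.

Lemma tcoef_zM sw F b c :
  tcoef sw (var_uv sw * F) b c = if b == 0%N then 0 else tcoef sw F b.-1 c.
Proof.
apply: fpsP => a; rewrite (fun_if (fun f => fpscoef f a)) fpscoef0.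
rewrite /tcoef /= /coef3 /var_uv; case: sw; rewrite fpscoefCM.
  by rewrite fpscoefCM fpscoefXM; case: eqP.
by rewrite fpscoefXM; case: eqP; rewrite ?fpscoef0.
Qed.

Lemma tcoef_zXM sw i F b c :
  tcoef sw (var_uv sw ^+ i * F) b c =
  if (b < i)%N then 0 else tcoef sw F (b - i) c.
Proof.
elim: i b => [|i IH] b; first by rewrite expr0 mul1r subn0.
by rewrite exprS -mulrA tcoef_zM IH; case: b.
Qed.

(* [F] involves t and a single one of u, v, and [P b] in Q[[t]] is its          *)
(* coefficient of z^b / b! in that variable z.                                 *)
Definition is_egf (sw : bool) (F : fps3) (P : nat -> fps rat) : Prop :=
  (forall b c, c != 0%N -> tcoef sw F b c = 0) /\
  (forall b, b`!%:R * tcoef sw F b 0 = P b).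

Lemma is_egfM sw F G P Q : is_egf sw F P -> is_egf sw G Q ->
  is_egf sw (F * G) (fun b => \sum_(j < b.+1) 'C(b, j)%:R * (P j * Q (b - j)%N)).
Proof.
move=> [F0 FP] [G0 GQ]; split=> [b c c0|b]; rewrite tcoefM.
  rewrite big1 // => j _; rewrite big1 // => m _.
  have [m0|m0] := eqVneq (m : nat) 0%N; last by rewrite F0 ?mul0r.
  by rewrite [tcoef _ G _ _]G0 ?mulr0 // m0 subn0.
rewrite mulr_sumr; apply: eq_bigr => j _; rewrite big_ord1 /= subn0.
have jb : (j <= b)%N by rewrite -ltnS.
by rewrite -FP -GQ -(bin_fact jb) !natrM; ring.
Qed.

Lemma is_egf_eq sw F P Q : (forall b, P b = Q b) -> is_egf sw F P -> is_egf sw F Q.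
Proof. by move=> PQ [F0 FP]; split=> // b; rewrite FP PQ. Qed.

Lemma is_egf_exp sw :
  is_egf sw (fps_subst fps_exp ((1 - var_t) * var_uv sw)) (fun b => (1 - fpsX _) ^+ b).
Proof.
have E i b c : tcoef sw (((1 - var_t) * var_uv sw) ^+ i) b c =
    ((b == i) && (c == 0%N))%:R * (1 - fpsX _) ^+ i.
  rewrite exprMn -[_ ^+ i * _]mulr1 -mulrA tcoef_1subtXM tcoef_zXM.
  rewrite [RHS]mulrC; congr (_ * _).
  case: ltngtP => [//|ib|->]; last by rewrite subnn tcoef1.
  by rewrite tcoef1 subn_eq0 leqNgt ib.
have S b c : tcoef sw (fps_subst fps_exp ((1 - var_t) * var_uv sw)) b c =
    Fps (fun a => (c == 0%N)%:R * b`!%:R^-1 * fpscoef ((1 - fpsX rat) ^+ b) a).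
  apply: fpsP => a.
  transitivity (\sum_(i < (a + b + c).+1) (i`!%:R)^-1 *
      fpscoef (tcoef sw (((1 - var_t) * var_uv sw) ^+ i) b c) a).
    by rewrite /tcoef /=; case: (sw); rewrite /coef3 /= ?(addnAC a c b).
  (* Only i = b contributes, and the truncation in [fps_subst] retains it. *)
  have bl : (b < (a + b + c).+1)%N by lia.
   rewrite (bigD1 (Ordinal bl)) // E eqxx big1 => [|i /eqP ib].
    by apply: etrans (addr0 _) _; rewrite fpscoef_natM /=; ring.
  rewrite E (_ : b == i = false) ?mul0r ?fpscoef0 ?mulr0 //.
  by apply/eqP => bi; apply: ib; apply: val_inj.
split=> [b c /negbTE c0|b]; rewrite S.
  by apply: fpsP => a; rewrite fpscoef0 /= c0 !mul0r.
apply: fpsP => a; rewrite fpscoef_natM /= mul1r mulrA mulfV ?mul1r //.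
by rewrite pnatr_eq0 -lt0n fact_gt0.
Qed.

Lemma is_egf_expX sw i :
  is_egf sw (fps_subst fps_exp ((1 - var_t) * var_uv sw) ^+ i)
    (fun b => i%:R ^+ b * (1 - fpsX _) ^+ b).
Proof.
elim: i => [|i IH].
  split=> [b c /negbTE c0|b]; rewrite expr0 tcoef1; first by rewrite c0 andbF.
  by rewrite andbT; case: b => [|b]; rewrite ?mulr1 // mulr0 expr0n mul0r.
rewrite exprSr; apply: is_egf_eq (is_egfM IH (is_egf_exp sw)) => b.
rewrite mulrS exprDn mulr_suml; apply: eq_bigr => j _.
have jb : (j <= b)%N by rewrite -ltnS.
have -> : (1 - fpsX rat) ^+ b = (1 - fpsX rat) ^+ j * (1 - fpsX rat) ^+ (b - j).
  by rewrite -exprD subnKC.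
by rewrite expr1n mul1r -[in RHS]mulr_natl !mulrA.
Qed.

Lemma is_egf_gser_subst sw k :
  is_egf sw (gser_subst k (var_uv sw))
    (fun b => (1 - fpsX _) ^+ b * Fps (fun i => i%:R ^+ k * i%:R ^+ b)).
Proof.
rewrite /gser_subst; set E := fps_subst fps_exp _.
have S a b c : fpscoef (tcoef sw (fps_subst (gser k) (var_t * E)) b c) a =
    \sum_(i < (a + b + c).+1) i%:R ^+ k *
      fpscoef (fpsX _ ^+ i * tcoef sw (E ^+ i) b c) a.
  under eq_bigr => i _ do rewrite -tcoef_tXM -exprMn.
  by rewrite /tcoef /=; case: (sw); rewrite /coef3 /= ?(addnAC a c b).
have E0 i := (is_egf_expX sw i).1; have EP i := (is_egf_expX sw i).2.
split=> [b c c0|b]; apply: fpsP => a.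
  rewrite S fpscoef0 big1 // => i _.
  by rewrite E0 // mulr0 fpscoef0 mulr0.
rewrite fpscoef_natM S mulr_sumr addn0 [in RHS]mulrC fpscoefM.
pose F i := i%:R ^+ k * i%:R ^+ b * fpscoef ((1 - fpsX rat) ^+ b) (a - i)%N.
(* The factor t^i kills the terms with i > a, which leaves a Cauchy product in t. *)
transitivity (\sum_(i < (a + b).+1 | (i < a.+1)%N) F i); last first.
  have ab : (a.+1 <= (a + b).+1)%N by rewrite ltnS leq_addr.
  by rewrite (big_ord_narrow ab).
rewrite [RHS]big_mkcond; apply: eq_bigr => i _.
rewrite mulrCA -fpscoef_natM mulrCA EP fpscoefXnM ltnS ltnNge.
case: (i <= a)%N; last by rewrite mulr0.
by rewrite -(natrX _ i b) fpscoef_natM natrX mulrA.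
Qed.

Lemma is_egfB sw F G P Q : is_egf sw F P -> is_egf sw G Q ->
  is_egf sw (F - G) (fun b => P b - Q b).
Proof.
move=> [F0 FP] [G0 GQ]; split=> [b c c0|b]; rewrite tcoefD tcoefN.
  by rewrite F0 ?G0 ?subr0.
by rewrite mulrBr FP GQ.
Qed.

Lemma is_egf_natb sw (x : bool) : is_egf sw x%:R (fun b => (x && (b == 0%N))%:R).
Proof.
case: x; split=> [b c /negbTE c0|b].
- by rewrite mulr1n tcoef1 c0 andbF.
- by rewrite mulr1n tcoef1 andbT; case: b => [|b]; rewrite ?mulr1 ?mulr0.
- by rewrite mulr0n tcoef0.
- by rewrite mulr0n tcoef0 mulr0.
Qed.

(* Discarding the constant term of g_0 amounts to summing over i > 0, since    *)
(* i ^+ (k + b) vanishes at i = 0 unless k = b = 0.                            *)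
Lemma is_egf_gser_subst_pos sw k :
  is_egf sw (gser_subst k (var_uv sw) - (k == 0%N)%:R)
    (fun b => (1 - fpsX _) ^+ b * Fps (fun i => (0 < i)%:R * (i%:R ^+ k * i%:R ^+ b))).
Proof.
apply: is_egf_eq (is_egfB (is_egf_gser_subst sw k) (is_egf_natb sw (k == 0%N))) => b.
have -> : ((k == 0%N) && (b == 0%N))%:R = (1 - fpsX _) ^+ b * ((k == 0%N) && (b == 0%N))%:R :> fps rat.
  by case: b => [|b]; rewrite ?mul1r // andbF mulr0n mulr0.
rewrite -mulrBr; congr (_ * _); apply: fpsP => i.
rewrite fpscoefD fpscoefN fpscoef_natb /=.
by case: i k b => [|i] [|k] [|b]; rewrite /= ?subr0 ?mul1r // !(mul0r, mulr0, expr0n, mulr1, subrr, subr0).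
Qed.

(** With j = m - i the summand is (i j)^k (i + j)^b; at b = k it is (i j (i + j))^k, the power of
    twice [alpha] or [beta]. *)
Definition pair_series (k b : nat) : fps rat :=
  Fps (fun m => \sum_(1 <= i < m) (i * (m - i))%:R ^+ k * m%:R ^+ b).

(** The binomial convolution of the powers of i and m - i is the power m^b of their sum. *)
Lemma is_egf_gser_subst_sqr sw k :
  is_egf sw ((gser_subst k (var_uv sw) - (k == 0%N)%:R) ^+ 2)
    (fun b => (1 - fpsX _) ^+ b * pair_series k b).
Proof.
rewrite expr2; have H := is_egf_gser_subst_pos sw k.
apply: is_egf_eq (is_egfM H H) => b.
pose S j : fps rat := Fps (fun i => (0 < i)%:R * (i%:R ^+ k * i%:R ^+ j)).
transitivity (\sum_(j < b.+1) (1 - fpsX rat) ^+ b * ('C(b, j)%:R * (S j * S (b - j)%N))).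
  apply: eq_bigr => j _; have jb : (j <= b)%N by rewrite -ltnS.
  by rewrite mulrACA -exprD subnKC // [LHS]mulrCA.
rewrite -mulr_sumr; congr (_ * _); apply: fpsP => m.
rewrite fpscoef_sum.
transitivity (\sum_(j < b.+1) \sum_(i < m.+1)
    'C(b, j)%:R * (fpscoef (S j) i * fpscoef (S (b - j)%N) (m - i)%N)).
  by apply: eq_bigr => j _; rewrite fpscoef_natM fpscoefM mulr_sumr.
(* The term i = m drops out, because its second index m - i is 0. *)
rewrite exchange_big /= big_ord_recr /= [X in _ + X]big1 => [|j _]; last first.
  by rewrite subnn !mul0r !mulr0.
rewrite addr0 big_geq_mkord big_mkcond [RHS]big_mkcond.
apply: eq_bigr => i _ /=; have im := ltn_ord i.
case: ltnP => i0; last by rewrite big1 // => j _; rewrite !mul0r mulr0.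
rewrite subn_gt0 im -[in m%:R](subnK (ltnW im)) natrD exprDn mulr_sumr.
apply: eq_bigr => j _; rewrite !mul1r natrM exprMn -[in RHS](mulr_natl (_ * _)).
ring.
Qed.

(** Multiplying by the unit (1 - t)^(k + l) removes the division; the same power arises from the
    coefficients of u^k and v^l in the two squares and is cancelled. *)
Lemma moment_series_coef k l n :
  k`!%:R * l`!%:R *
  coef3 ((gser_subst k var_u - (k == 0%N)%:R) ^+ 2 *
         (gser_subst l var_v - (l == 0%N)%:R) ^+ 2 /
         (1 - var_t) ^+ (k + l)) n k l =
  fpscoef (pair_series k k * pair_series l l) n.
Proof.
have [U0 UP] := is_egf_gser_subst_sqr false k.
have [V0 VP] := is_egf_gser_subst_sqr true l.
rewrite /var_uv in U0 UP V0 VP.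
set U := (_ ^+ 2) in U0 UP *; set V := (_ ^+ 2) in V0 VP *.
have sw F b c : tcoef true F b c = tcoef false F c b by [].
have u1 : (1 - var_t) ^+ (k + l) \is a GRing.unit by rewrite unitrX // fps_unit_1subX.
have u2 : (1 - fpsX rat) ^+ (k + l) \is a GRing.unit by rewrite unitrX // fps_unit_1subX.
rewrite -natrM -[coef3 _ n k l]/(fpscoef (tcoef false (U * V / (1 - var_t) ^+ (k + l)) k l) n).
rewrite -fpscoef_natM; congr (fpscoef _ n); apply: (mulrI u2).
rewrite mulrCA -tcoef_1subtXM [in LHS](mulrC (_ ^+ (k + l))) divrK // tcoefM.
(* U is free of v and V is free of u, so only the coefficient of u^k in U times that of v^l in V
   survives. *)
rewrite (bigD1 ord_max) //= [X in _ + X]big1 => [|j jk]; last first.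
  apply: big1 => m _.
  have jk' : (k - j != 0)%N.
    by rewrite subn_eq0 -ltnNge ltn_neqAle -ltnS ltn_ord andbT -(inj_eq val_inj) in jk *.
  by rewrite -(sw V) V0 ?mulr0.
rewrite addr0 (bigD1 ord0) //= big1 ?addr0 => [|m m0]; last by rewrite U0 ?mul0r.
rewrite subnn subn0 -(sw V) natrM mulrACA UP VP exprD; ring.
Qed.

Lemma sum_bigrassmannian_moment k l n :
  (\sum_(w in bigrassmannian n) (alpha w)%:R ^+ k * (beta w)%:R ^+ l) * 2 ^+ (k + l) =
  fpscoef (pair_series k k * pair_series l l) (n + 2) :> rat.
Proof.
(* Here i = a + 1, m = i + (n - c + 1) and q = b - a. Then c - a = n + 2 - m, so m and n + 2 - m are
   the degrees of the [alpha] and [beta] factors. *)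
pose h mi q : nat * nat * nat := (mi.2.-1, mi.2.-1 + q, mi.2.-1 + (n + 2 - mi.1))%N.
pose s := [seq h mi q | mi <- [seq (m, i) | m <- index_iota 0 (n + 2).+1, i <- index_iota 1 m],
                        q <- index_iota 1 (n + 2 - mi.1)].
have memS m i : ((m, i) \in [seq (m, i) | m <- index_iota 0 (n + 2).+1, i <- index_iota 1 m]) =
   (m <= n + 2)%N && (0 < i < m)%N.
  apply/allpairsPdep/idP => [[m' [i' [+ + [-> ->]]]]|H].
    by rewrite !mem_index_iota; lia.
  by exists m, i; rewrite !mem_index_iota; split=> //; lia.
transitivity (\sum_(w in bigrassmannian n | predT w)
    (alpha w * 2)%:R ^+ k * (beta w * 2)%:R ^+ l : rat).
  rewrite mulr_suml; apply: eq_big => [w|w _]; first by rewrite andbT.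
  by rewrite !natrM !exprMn exprD; ring.
rewrite (@big_bigrassmannian _ _ _ n _ s).
- rewrite big_allpairs_dep big_allpairs_dep fpscoefM big_mkord.
  apply: eq_bigr => m _ /=; rewrite mulr_suml.
  rewrite big_seq [RHS]big_seq; apply: eq_bigr => i; rewrite mem_index_iota => im.
  rewrite mulr_sumr big_seq [RHS]big_seq; apply: eq_bigr => q; rewrite mem_index_iota => qm.
  have abc : (i.-1 < i.-1 + q < i.-1 + (n + 2 - m))%N by lia.
  have cn : (i.-1 + (n + 2 - m) <= n)%N by lia.
  rewrite /triple_perm /= alpha_block_perm // beta_block_perm //.
  rewrite -!exprMn -!natrM; congr (_%:R ^+ _ * _%:R ^+ _); congr (_ * _ * _)%N; lia.
- apply: uniq_allpairs_dep => [|mi|[m i] q [m' i'] q'].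
  + apply: uniq_allpairs_dep => [|m|m i m' i' _ _ _ _ //]; exact: iota_uniq.
  + exact: iota_uniq.
  rewrite !memS !mem_index_iota => im qm im' qm' /= [e1 e2 e3].
  by have [-> -> ->] : [/\ m = m', i = i' & q = q'] by split; lia.
move=> [[a b] c]; rewrite andbT /triple_valid /=.
apply/allpairsPdep/idP => [[[m i] [q [/= + + [-> -> ->]]]]|abc].
  by rewrite memS mem_index_iota /=; lia.
exists (a.+1 + (n - c).+1, a.+1)%N, (b - a)%N; rewrite memS mem_index_iota /h /=; split; try lia.
by congr (_, _, _); lia.
Qed.

Theorem theorem1p3 (k l n : nat) (hn : (2 <= n)%N) :
  unif_expectation (bigrassmannian n)
    (fun w : 'S_n => (alpha w)%:R ^+ k * (beta w)%:R ^+ l) =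
  (k`!%:R * l`!%:R) / (2 ^+ (k + l) * #|bigrassmannian n|%:R) *
  coef3 ((gser_subst k var_u - (k == 0%N)%:R) ^+ 2 *
         (gser_subst l var_v - (l == 0%N)%:R) ^+ 2 /
         (1 - var_t) ^+ (k + l)) (n + 2) k l.
Proof.
rewrite mulrAC moment_series_coef -sum_bigrassmannian_moment /unif_expectation.
by rewrite invfM mulrA mulfK // expf_neq0.
Qed.
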